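(* Let $(\Omega,\mathcal{F},\mathbf{P})$ be a probability space with $\sigma$-fields $\{\emptyset,\Omega\}=\mathcal{F}_0\subseteq\mathcal{F}_1\subseteq\cdots\subseteq\mathcal{F}_n\subseteq\mathcal{F}$, and let $(\xi_i,\mathcal{F}_i)_{i=1,\dots,n}$ be a sequence of conditionally symmetric martingale differences, i.e. each $\xi_i$ is real-valued, $\mathcal{F}_i$-measurable, integrable, $\mathbf{E}(\xi_i\mid\mathcal{F}_{i-1})=0$, and $\mathbf{P}(\xi_i>y\mid\mathcal{F}_{i-1})=\mathbf{P}(\xi_i<-y\mid\mathcal{F}_{i-1})$ for all $i$ and all $y\ge0$. Let $S_k=\sum_{i=1}^k\xi_i$ and, for $y\ge0$, \[ \mathrm{M}_k^{y}=\sum_{i=1}^k\Big(\mathbf{E}\big(\xi_i^2\mathbf{1}_{\{|\xi_i|\le y\}}\mid\mathcal{F}_{i-1}\big)+\xi_i^2\mathbf{1}_{\{|\xi_i|>y\}}\Big). \] Then for all $x,v>0$ and all $y\ge0$, \[ \mathbf{P}\Big(S_k\ge x\ \text{and}\ \mathrm{M}_k^{y}\le v^2\ \text{for some}\ k\in[1,n]\Big)\le B_0(x,y,v), \] where for $y>0$ \[ B_0(x,y,v)=\exp\left\{-\lambda x+\left(\frac{\cosh(\lambda y)-1}{y^2}\right)v^2\right\},\qquad \lambda=\frac1y\log\left(\sqrt{1+\frac{x^2y^2}{v^4}}+\frac{xy}{v^2}\right), \] and for $y=0$ one sets $B_0(x,0,v)=\lim_{y\to0+}B_0(x,y,v)=\exp\{-x^2/(2v^2)\}$.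 *)

(* Defs.v *)
From HB Require Import structures.
From mathcomp Require Import all_boot all_order all_algebra.
From mathcomp Require Import all_classical all_reals all_analysis.
Set Implicit Arguments. Unset Strict Implicit. Unset Printing Implicit Defensive.
Import Order.TTheory GRing.Theory Num.Theory.
Local Open Scope classical_set_scope.
Local Open Scope ring_scope.

Definition sub_measurable {d} {T : measurableType d} {R : realType}
  (G : set (set T)) (g : T -> R) : Prop :=
  forall B : set R, measurable B -> G (g @^-1` B).

Definition cond_exp_version {d} {T : measurableType d} {R : realType}
  (P : probability T R) (G : set (set T)) (f g : T -> R) : Prop :=
  [/\ sub_measurable G g,
      P.-integrable setT (fun w => (g w)%:E) &
      forall A, G A -> (\int[P]_(w in A) (g w)%:E = \int[P]_(w in A) (f w)%:E)%E].

Definition coshR {R : realType} (a : R) : R := (expR a + expR (- a)) / 2.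

(* The bound B_0(x, y, v) of the paper (y = 0 case: the limit value). *)
Definition B0 {R : realType} (x y v : R) : R :=
  if y == 0 then expR (- (x ^+ 2) / (2 * v ^+ 2))
  else
    let lam := ln (Num.sqrt (1 + x ^+ 2 * y ^+ 2 / v ^+ 4) + x * y / v ^+ 2) / y in
    expR (- lam * x + (coshR (lam * y) - 1) / y ^+ 2 * v ^+ 2).

(* Main.v *)
(** With [f := (cosh (lam y) - 1) / y^2] (and [f := lam^2 / 2] when [y = 0]),
    [Z_k := exp (lam S_k - f M_k^y)] is a nonnegative supermartingale, and it is
    at least [exp (lam x - f v^2)] on the event of the theorem, so that Ville's
    maximal inequality gives the bound; only [lam >= 0] matters, not the optimal
    value of [lam].  For the supermartingale property, conditional symmetry
    replaces [exp (lam xi)] by [cosh (lam xi)]; this is at most [1 + f xi^2] when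
    [`|xi| <= y], because [(cosh t - 1) / t^2] is increasing, and at most
    [exp (lam^2 xi^2 / 2) <= exp (f xi^2)] otherwise, so that the conditional
    expectation of [exp (lam xi - f xi^2 1_{`|xi| > y})] is at most
    [1 + f c <= exp (f c)]. *)
Require Import Defs.
From HB Require Import structures.
From mathcomp Require Import all_boot all_order all_algebra.
From mathcomp Require Import all_classical all_reals all_analysis.
From mathcomp Require Import measurable_realfun ring lra.
Import Order.TTheory GRing.Theory Num.Theory.
Import numFieldNormedType.Exports.
Local Open Scope classical_set_scope.
Local Open Scope ring_scope.

(** * Power series bounds for the hyperbolic cosine *)

Section hyperbolic_cosine.
Variable R : realType.
Implicit Types a b s t : R.

(** Averaging the exponential coefficients at [a] and [- a] lets convergence of the series be
    inherited from that of the exponential. *)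
Definition cosh_coeff a : R^nat := fun k => (exp_coeff a k + exp_coeff (- a) k) / 2.

Lemma cosh_coeff_odd a k : odd k -> cosh_coeff a k = 0.
Proof.
by move=> k_odd; rewrite /cosh_coeff /exp_coeff/= exprNn -signr_odd k_odd; lra.
Qed.

Lemma cosh_coeff_even a k : ~~ odd k -> cosh_coeff a k = a ^+ k / k`!%:R.
Proof.
move=> /negbTE k_even.
by rewrite /cosh_coeff /exp_coeff/= exprNn -signr_odd k_even; lra.
Qed.

Lemma cosh_coeff_ge0 a k : 0 <= cosh_coeff a k.
Proof.
case: (boolP (odd k)) => [/cosh_coeff_odd -> //|k_even].
rewrite cosh_coeff_even// divr_ge0//.
by rewrite real_exprn_even_ge0// num_real.
Qed.

Lemma cvg_series_cosh_coeff a : series (cosh_coeff a) @ \oo --> coshR a.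
Proof.
have -> : series (cosh_coeff a) =
    (fun n => (series (exp_coeff a) n + series (exp_coeff (- a)) n) / 2).
  by apply/funext => n; rewrite /series/= -big_split/= -mulr_suml.
apply: cvgMl; apply: cvgD; exact: is_cvg_series_exp_coeff.
Qed.

Lemma series_cosh_coeff_le a n : series (cosh_coeff a) n <= coshR a.
Proof.
rewrite -(cvg_lim (@Rhausdorff R) (cvg_series_cosh_coeff a)).
apply: nondecreasing_cvgn_le; last by apply/cvg_ex; eexists; exact: cvg_series_cosh_coeff.
by apply/nondecreasing_series => k _ _; exact: cosh_coeff_ge0.
Qed.

Lemma coshR_le_series a b :
  (forall n, series (cosh_coeff a) n <= b) -> coshR a <= b.
Proof.
move=> ab; rewrite -(cvg_lim (@Rhausdorff R) (cvg_series_cosh_coeff a)).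
apply: limr_le; first by apply/cvg_ex; eexists; exact: cvg_series_cosh_coeff.
by near=> n; exact: ab.
Unshelve. all: by end_near. Qed.

Lemma coshR_ge1D a : 1 + a ^+ 2 / 2 <= coshR a.
Proof.
apply: le_trans (series_cosh_coeff_le a 3).
rewrite /series/= !big_nat_recr//= big_geq// add0r.
by rewrite (@cosh_coeff_odd _ 1)// !cosh_coeff_even// expr0 addr0 divr1.
Qed.

Lemma coshR_ge1 a : 1 <= coshR a.
Proof. by apply: le_trans (coshR_ge1D a); rewrite lerDl divr_ge0// sqr_ge0. Qed.

(** From [k] to [k.+1] the left side gains the factor 2k+2, the right side (2k+2)(2k+1). This
    compares the coefficients of cosh a with those of exp(a^2/2). *)
Lemma fact_double_ge k : (2 ^ k * k`! <= k.*2`!)%N.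
Proof.
elim: k => // k IH; rewrite doubleS !factS expnS.
apply: (@leq_trans (k.*2.+2 * (2 ^ k * k`!))); last first.
  by rewrite leq_mul2l/= (leq_trans IH)// leq_pmull.
by rewrite -doubleS -muln2 mulnACA mulnA (mulnC 2) mulnA.
Qed.

Lemma cosh_coeff_double_le a k : cosh_coeff a k.*2 <= exp_coeff (a ^+ 2 / 2) k.
Proof.
rewrite cosh_coeff_even ?odd_double// /exp_coeff/= -mul2n exprM expr_div_n -[leRHS]mulrA -invfM.
rewrite ler_wpM2l ?(exprn_ge0 _ (sqr_ge0 _))// lef_pV2 ?posrE ?mulr_gt0 ?exprn_gt0
  ?ltr0n ?fact_gt0//.
by rewrite -natrX -natrM ler_nat mul2n fact_double_ge.
Qed.

Lemma coshR_le_expR_sqr a : coshR a <= expR (a ^+ 2 / 2).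
Proof.
have a2 : 0 <= a ^+ 2 / 2 by rewrite divr_ge0// sqr_ge0.
(* The odd coefficients vanish, so [n.*2] terms of the cosh series are matched with [n] terms of the
   exponential series in a^2/2. *)
have serE n : series (cosh_coeff a) n.*2 <= series (exp_coeff (a ^+ 2 / 2)) n.
  elim: n => [|n IH]; first by rewrite /series/= !big_geq.
  rewrite /series/= doubleS !big_nat_recr//= in IH *.
  by rewrite (@cosh_coeff_odd _ n.*2.+1) ?addr0/= ?odd_double// lerD// cosh_coeff_double_le.
have ser_le n : series (exp_coeff (a ^+ 2 / 2)) n <= expR (a ^+ 2 / 2).
  apply: nondecreasing_cvgn_le; last exact: is_cvg_series_exp_coeff.
  by apply/nondecreasing_series => k _ _; exact: exp_coeff_ge0.
apply: coshR_le_series => n; apply: le_trans (ser_le n); apply: le_trans (serE n).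
(* The partial sum at [n] is at most the one at [n.*2], the coefficients being nonnegative. *)
have : nondecreasing_seq (series (cosh_coeff a)).
  by apply/nondecreasing_series => k _ _; exact: cosh_coeff_ge0.
by apply; rewrite -addnn leq_addl.
Qed.

(* Comparing the power series term by term: [t ^+ k * s ^+ 2 <= s ^+ k * t ^+ 2]
   for even [k >= 2]. *)
Lemma coshR_quadratic_le s t : `|t| <= s ->
  (coshR t - 1) * s ^+ 2 <= (coshR s - 1) * t ^+ 2.
Proof.
move=> ts; have s0 : 0 <= s by exact: le_trans ts.
case: (eqVneq s 0) => [s00|s_neq0].
  move: ts; rewrite s00 normr_le0 => /eqP ->.
  by rewrite !expr0n/= !mulr0.
have s2_gt0 : 0 < s ^+ 2 by rewrite exprn_gt0// lt_neqAle eq_sym s_neq0.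
rewrite -ler_pdivlMr// lerBlDr; apply: coshR_le_series => n.
have term k : (0 < k)%N -> cosh_coeff t k <= cosh_coeff s k * t ^+ 2 / s ^+ 2.
  move=> k0; case: (boolP (odd k)) => [ko|ke]; first by rewrite !cosh_coeff_odd// !mul0r.
  have [m kE] : exists m, k = (2 + m.*2)%N.
    exists (k.-2)./2; move: k0 ke; case: k => [//|[//|k]] _ /=.
    by rewrite negbK => ke; rewrite halfK (negbTE ke) subn0.
  rewrite ler_pdivlMr// !cosh_coeff_even// kE !exprD.
  have -> : t ^+ 2 * t ^+ m.*2 / (2 + m.*2)`!%:R * s ^+ 2 =
            t ^+ 2 * s ^+ 2 / (2 + m.*2)`!%:R * t ^+ m.*2 by ring.
  have -> : s ^+ 2 * s ^+ m.*2 / (2 + m.*2)`!%:R * t ^+ 2 =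
            t ^+ 2 * s ^+ 2 / (2 + m.*2)`!%:R * s ^+ m.*2 by ring.
  apply: ler_wpM2l; first by rewrite divr_ge0// mulr_ge0// sqr_ge0.
  rewrite -mul2n !exprM lerXn2r ?nnegrE ?sqr_ge0//.
  by rewrite -(real_normK (num_real t)) lerXn2r ?nnegrE.
(* The termwise bound fails for the constant term, which is split off and cancels the [- 1] of the
   claim; the empty partial sum has no such term. *)
case: n => [|n].
  rewrite /series/= big_geq// addr_ge0// divr_ge0 ?sqr_ge0// mulr_ge0 ?sqr_ge0//.
  by rewrite subr_ge0 coshR_ge1.
have head0 u : cosh_coeff u 0 = 1 by rewrite cosh_coeff_even// expr0 divr1.
rewrite /series/= big_nat_recl// head0 addrC lerD2r.
apply: (@le_trans _ _ (\sum_(0 <= k < n) cosh_coeff s k.+1 * (t ^+ 2 / s ^+ 2))).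
  by apply: ler_sum => k _; rewrite mulrA term.
rewrite -mulr_suml -[leRHS]mulrA ler_wpM2r ?divr_ge0 ?sqr_ge0// lerBrDl.
by have := series_cosh_coeff_le s n.+1; rewrite /series/= big_nat_recl// head0.
Qed.

End hyperbolic_cosine.

(** * Measurability of level sets *)

Section superlevel_sets.
Context {d} {T : measurableType d} {R : realType}.

Lemma measurable_gt_set (f : T -> R) (z : R) :
  measurable_fun setT f -> measurable [set w | z < f w].
Proof.
move=> mf; rewrite [X in measurable X](_ : _ = setT `&` f @^-1` `]z, +oo[%classic).
  exact: mf.
by rewrite setTI; apply/seteqP; split=> w/=; rewrite in_itv/= andbT.
Qed.

Lemma measurable_ge_set (f : T -> R) (z : R) :
  measurable_fun setT f -> measurable [set w | z <= f w].
Proof.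
move=> mf; rewrite [X in measurable X](_ : _ = setT `&` f @^-1` `[z, +oo[%classic).
  exact: mf.
by rewrite setTI; apply/seteqP; split=> w/=; rewrite in_itv/= andbT.
Qed.

Lemma measurable_le_set (f : T -> R) (z : R) :
  measurable_fun setT f -> measurable [set w | f w <= z].
Proof.
move=> mf; rewrite [X in measurable X](_ : _ = setT `&` f @^-1` `]-oo, z]%classic).
  exact: mf.
by rewrite setTI; apply/seteqP; split=> w/=; rewrite in_itv.
Qed.

End superlevel_sets.

(** * Measurability with respect to a sub-sigma-algebra *)

Section sub_measurable.
Context {d} {T : measurableType d} {R : realType} (G : set (set T)).
Hypotheses (sG : sigma_algebra setT G) (GT : G `<=` measurable).

Lemma measurable_g_sigma_algebraE : @measurable _ (g_sigma_algebraType G) = G.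
Proof. exact: sigma_algebra_id. Qed.

Lemma g_sigma_algebra_measurable (A : set T) :
  measurable (A : set (g_sigma_algebraType G)) -> G A.
Proof. by rewrite measurable_g_sigma_algebraE. Qed.

(** Turning [G] into a measurable type makes the closure properties of measurable functions
    available for [G]. *)
Lemma sub_measurableP (g : T -> R) :
  sub_measurable G g <-> measurable_fun setT (g : g_sigma_algebraType G -> R).
Proof.
split=> mg; first by move=> _ B mB; rewrite setTI measurable_g_sigma_algebraE; exact: mg.
by move=> B mB; rewrite -measurable_g_sigma_algebraE -[X in measurable X]setTI; exact: mg.
Qed.

Lemma sub_measurable_measurable (g : T -> R) :
  sub_measurable G g -> measurable_fun setT g.
Proof. by move=> mg _ B mB; rewrite setTI; apply/GT/mg. Qed.

End sub_measurable.

(** * Integrals with a [G]-measurable weight *)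

Section weighted_integral.
Context {d} {T : measurableType d} {R : realType} (mu : {measure set T -> \bar R}).
Variable G : set (set T).
Hypotheses (sG : sigma_algebra setT G) (GT : G `<=` measurable).
Local Open Scope ereal_scope.
Import HBNNSimple.

(** Since [h] is a finite combination of indicators of its fibres, and these lie in [G], only
    integrals of [f] over sets of [G] remain. *)
Lemma ge0_integral_nnsfun_mul (A : set T) (f : T -> \bar R)
  (h : {nnsfun (g_sigma_algebraType G) >-> R}) :
  G A -> measurable_fun setT f -> (forall w, 0 <= f w) ->
  \int[mu]_(w in A) ((h w)%:E * f w) =
  \sum_(r \in range h) (r%:E * \int[mu]_(w in A `&` h @^-1` [set r]) f w).
Proof.
move=> GA mf f0; have mA := GT _ GA.
have Ghr r : G (h @^-1` [set r]).
  by apply: (g_sigma_algebra_measurable _ sG); exact: measurable_sfunP.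
have mhr r : measurable (h @^-1` [set r] : set T) by exact: GT.
under eq_integral => w _.
  rewrite (fimfunE h) -fsumEFin// ge0_mule_fsuml; last first.
    by move=> r; exact: nnfun_muleindic_ge0.
  over.
rewrite ge0_integral_fsum//; last 2 first.
- move=> r; apply: emeasurable_funM; last exact: measurable_funTS.
  apply/measurable_EFinP; exact: measurable_funM.
- by move=> r w _; rewrite mule_ge0// nnfun_muleindic_ge0.
apply: eq_fsbigr => r rh.
have r0 : (0 <= r)%R by move: rh; rewrite inE => -[w _ <-].
under eq_integral do rewrite EFinM -muleA.
rewrite ge0_integralZl//; last 2 first.
- apply: emeasurable_funM; last exact: measurable_funTS.
  by apply/measurable_EFinP; exact: measurable_indic.
- by move=> w _; rewrite mule_ge0// lee_fin.
congr (_ * _); rewrite integral_mkcondr.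
by apply: eq_integral => w _; rewrite epatch_indic muleC.
Qed.

(* Approximating [W] from below by [G]-simple functions, the two integrals are
   limits of the same linear combinations of integrals over sets of [G]. *)
Lemma ge0_eq_integral_weight (A : set T) (f g W : T -> R) :
  G A -> measurable_fun setT f -> measurable_fun setT g ->
  (forall w, 0 <= f w)%R -> (forall w, 0 <= g w)%R ->
  (forall B, G B -> \int[mu]_(w in B) (f w)%:E = \int[mu]_(w in B) (g w)%:E) ->
  sub_measurable G W -> (forall w, 0 <= W w)%R ->
  \int[mu]_(w in A) ((W w)%:E * (f w)%:E) = \int[mu]_(w in A) ((W w)%:E * (g w)%:E).
Proof.
move=> GA mf mg f0 g0 fg /(sub_measurableP _ sG) mW W0; have mA := GT _ GA.
pose T' := g_sigma_algebraType G.
have mW' : measurable_fun [set: T'] (EFin \o (W : T' -> R)) by exact/measurable_EFinP.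
pose h := nnsfun_approx (@measurableT _ T') mW'.
have GI B C : G B -> G C -> G (B `&` C).
  by rewrite -(measurable_g_sigma_algebraE _ sG); exact: measurableI.
have lim_h (k : T -> R) : measurable_fun setT k -> (forall w, 0 <= k w)%R ->
    \int[mu]_(w in A) ((W w)%:E * (k w)%:E) =
    limn (fun n => \int[mu]_(w in A) ((h n w)%:E * (k w)%:E)).
  move=> mk k0; rewrite -monotone_convergence//.
  - apply: eq_integral => w _; apply/esym/cvg_lim => //.
    apply: cvgeZr => //.
    by apply: cvg_nnsfun_approx => // u _; rewrite lee_fin.
  - move=> n; apply: emeasurable_funM; last exact/measurable_EFinP/measurable_funTS.
    apply/measurable_EFinP/measurable_funTS/(sub_measurable_measurable G) => //.
    by apply/(sub_measurableP _ sG); exact: measurable_funPT.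
  - by move=> n w _; rewrite mule_ge0// lee_fin.
  - move=> w _ m n mn; rewrite lee_wpmul2r ?lee_fin//.
    by have /lefP/(_ w) := nd_nnsfun_approx measurableT mW' mn.
rewrite !lim_h//; congr (limn _); apply/funext => n.
rewrite !ge0_integral_nnsfun_mul//; try exact/measurable_EFinP.
apply: eq_fsbigr => r _; congr (_ * _).
apply: fg; apply: GI => //.
by apply: (g_sigma_algebra_measurable _ sG); exact: measurable_sfunP.
Qed.

End weighted_integral.

(** * Symmetry in law, unconditional and conditional *)

Section symmetric_law.
Context {d} {T : measurableType d} {R : realType} (P : probability T R).
Local Open Scope ereal_scope.

(** Open right rays are stable under intersection and generate the Borel sets; the rays from [- k]
    exhaust the line and have finite mass. *)
Lemma measure_eq_oray (m1 m2 : {measure set R -> \bar R}) :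
  m1 setT < +oo -> (forall z : R, m1 `]z, +oo[%classic = m2 `]z, +oo[%classic) ->
  forall B, measurable B -> m1 B = m2 B.
Proof.
move=> m1oo m12; apply: (measure_unique (@RGenOInfty.G R) (fun k => `](- k%:R)%R, +oo[%classic)).
- exact: RGenOInfty.measurableE.
- move=> _ _ [a ->] [b ->]; exists (Num.max a b).
  apply/seteqP; split=> t /=; rewrite !in_itv/= !andbT gt_max; last by move/andP.
  by move=> [-> ->].
- by move=> k; eexists.
- apply/seteqP; split=> // t _; exists (Num.truncn `|t|%R).+1 => //=.
  rewrite in_itv/= andbT ltrNl (le_lt_trans (ler_norm _))// normrN.
  exact: truncnS_gt.
- by move=> _ [a ->].
- by move=> k; rewrite (le_lt_trans _ m1oo)// le_measure ?inE.
Qed.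

(** Continuity from above. The thresholds u - u/(n+1) are all nonnegative, so a symmetry assumption
    restricted to nonnegative levels applies to each. *)
Lemma cvg_probability_gt (X : T -> R) (u : R) : measurable_fun setT X -> (0 < u)%R ->
  (fun n => P [set w | (X w > u - u / n.+1%:R)%R]) @ \oo --> P [set w | (X w >= u)%R].
Proof.
move=> mX u0; have mXgt z := measurable_gt_set X z mX.
pose F n := [set w | (X w > u - u / n.+1%:R)%R].
have FE : \bigcap_n F n = [set w | (X w >= u)%R].
  apply/seteqP; split=> w /= Xw; last first.
    by move=> n _; rewrite /F/= (lt_le_trans _ Xw)// ltrBlDr ltrDl divr_gt0.
  apply/ler_addgt0Pr => e e0.
  (* For this index, u/(n+1) is at most [e]. *)
  have := Xw (Num.truncn (u / e)) I; rewrite /F/= ltrBlDr => /ltW/le_trans; apply.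
  by rewrite lerD2l ler_pdivrMr// mulrC -ler_pdivrMr// ltW// truncnS_gt.
rewrite -FE; apply: nonincreasing_cvg_mu => //.
- by rewrite (le_lt_trans (probability_le1 _ _))// ltry.
- exact: bigcapT_measurable.
- move=> m n mn; apply/subsetPset => w /=; apply: le_lt_trans.
  by rewrite lerD2l lerN2 (ler_wpM2l (ltW u0))// lef_pV2 ?posrE// ler_nat.
Qed.

(** For negative [z], complements reduce the claim to the non-strict tails at [- z > 0], which are
    limits of strict tails at nonnegative levels. *)
Lemma symmetric_oray (X : T -> R) : measurable_fun setT X ->
  (forall z, 0 <= z -> P [set w | X w > z] = P [set w | X w < - z])%R ->
  forall z : R, P (X @^-1` `]z, +oo[%classic) = P ((\- X)%R @^-1` `]z, +oo[%classic).
Proof.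
move=> mX symX z.
have oE (Y : T -> R) (a : R) : Y @^-1` `]a, +oo[%classic = [set w | (Y w > a)%R].
  by apply/seteqP; split=> w/=; rewrite in_itv/= andbT.
have NE (a : R) : [set w | (- X w > a)%R] = [set w | (X w < - a)%R].
  by apply/seteqP; split=> w/=; rewrite ltrNr.
rewrite !oE NE; have [z0|z0] := leP 0%R z; first exact: symX.
have mXN : measurable_fun setT (\- X)%R by exact: measurableT_comp.
have Nz0 : (0 < - z)%R by rewrite oppr_gt0.
have ge_eq : P [set w | (X w >= - z)%R] = P [set w | (- X w >= - z)%R].
  rewrite -(cvg_lim (@ereal_hausdorff R) (cvg_probability_gt _ _ mX Nz0)).
  rewrite -(cvg_lim (@ereal_hausdorff R) (cvg_probability_gt _ _ mXN Nz0)).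
  congr (limn _); apply/funext => n; rewrite NE symX// subr_ge0 ler_pdivrMr//.
  by rewrite (ler_peMr (ltW Nz0))// ler1n.
have ltC (Y : T -> R) (a : R) : measurable_fun setT Y ->
    P [set w | (Y w < a)%R] = 1 - P [set w | (Y w >= a)%R].
  move=> mY; rewrite -probability_setC.
    by congr (P _); apply/seteqP; split=> w /=; rewrite ltNge => /negP.
  exact: measurable_ge_set.
rewrite (ltC _ _ mX) ge_eq -(ltC _ _ mXN); congr (P _).
by apply/seteqP; split=> w /=; rewrite ltrN2.
Qed.

(** [X] and [- X] have the same image measure, so a change of variables applies to both sides. *)
Lemma symmetric_integral (X : T -> R) (h : R -> R) :
  measurable_fun setT X -> measurable_fun setT h -> (forall t, 0 <= h t)%R ->
  (forall z, 0 <= z -> P [set w | X w > z] = P [set w | X w < - z])%R ->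
  \int[P]_w (h (X w))%:E = \int[P]_w (h (- X w))%:E.
Proof.
move=> mX mh h0 symX.
have mXN : measurable_fun setT (\- X)%R by exact: measurableT_comp.
have E (Y : T -> R) (mY : measurable_fun setT Y) :
    \int[P]_w (h (Y w))%:E = \int[pushforward P Y]_t (h t)%:E.
  rewrite ge0_integral_pushforward//; last 2 first.
    exact/measurable_EFinP.
    by move=> t _; rewrite lee_fin.
rewrite (E X)// (E (\- X)%R)//; apply: eq_measure_integral => B mB _.
apply: measure_eq_oray => //.
- by rewrite /= /pushforward preimage_setT probability_setT ltry.
- exact: symmetric_oray.
Qed.

(** Integrating the common version [g] over [A] equates the two tail probabilities on [A], which
    reduces the claim to the unconditional case. *)
Lemma cond_symmetric_integral (G : set (set T)) (A : set T) (X : T -> R) (h : R -> R) :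
  G `<=` measurable -> G A ->
  measurable_fun setT X -> measurable_fun setT h -> (forall t, 0 <= h t)%R ->
  (forall z : R, (0 <= z)%R -> exists g : T -> R,
     cond_exp_version P G (\1_[set w | X w > z]%R) g /\
     cond_exp_version P G (\1_[set w | X w < - z]%R) g) ->
  \int[P]_(w in A) (h (X w))%:E = \int[P]_(w in A) (h (- X w))%:E.
Proof.
move=> GT GA mX mh h0 symX; have mA := GT _ GA.
have mXN : measurable_fun setT (\- X)%R by exact: measurableT_comp.
(* [Y] is symmetric in law, and equals [X] on [A] and [0] elsewhere. *)
pose Y w := (X w * \1_A w)%R.
have mY : measurable_fun setT Y.
  by apply: measurable_funM => //; exact: measurable_indic.
have YA w : A w -> Y w = X w by move=> Aw; rewrite /Y indicE mem_set// mulr1.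
have YNA w : ~ A w -> Y w = 0%R by move=> Aw; rewrite /Y indicE memNset// mulr0.
have symY z : (0 <= z)%R -> P [set w | (Y w > z)%R] = P [set w | (Y w < - z)%R].
  move=> z0; have [g [[_ _ gt] [_ _ lt]]] := symX z z0.
  have mlt : measurable [set w | (X w < - z)%R].
    rewrite [X in measurable X](_ : _ = [set w | (- X w > z)%R]); first exact: measurable_gt_set.
    by apply/seteqP; split=> w/=; rewrite ltrNr.
  have := etrans (esym (gt A GA)) (lt A GA).
  rewrite !integral_indic//; last exact: measurable_gt_set.
  congr (_ = _); congr (P _); apply/seteqP; split=> w /=.
  - by move=> [Xw Aw]; rewrite YA.
  - have [Aw|/YNA ->] := pselect (A w); first by rewrite YA.
    by rewrite ltNge z0.
  - by move=> [Xw Aw]; rewrite YA.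
  - have [Aw|/YNA ->] := pselect (A w); first by rewrite YA.
    by rewrite ltrNr oppr0 ltNge z0.
have split_int (k : R -> R) : measurable_fun setT k -> (forall t, 0 <= k t)%R ->
    \int[P]_w (k (Y w))%:E = \int[P]_(w in A) (k (X w))%:E + (k 0%R)%:E * P (~` A).
  move=> mk k0; rewrite -(setUv A) ge0_integral_setU//; first last.
  - by apply/disj_setPCl.
  - by move=> w _; rewrite lee_fin.
  - by apply/measurable_EFinP; rewrite setUv; exact: measurableT_comp.
  - exact: measurableC.
  congr (_ + _); first by apply: eq_integral => w /[!inE] Aw; rewrite YA.
  rewrite -integral_cst; last exact: measurableC.
  by apply: eq_integral => w /[!inE] Aw; rewrite YNA.
have := symmetric_integral Y h mY mh h0 symY.
have mhN : measurable_fun setT (fun t : R => h (- t)%R) by exact: measurableT_comp.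
rewrite (split_int h)// (split_int (fun t => h (- t)%R))// oppr0.
(* The complement of [A] contributes this same term to both sides; being finite, it can be cancelled
   in the extended reals. *)
have fin_c : (h 0%R)%:E * P (~` A) \is a fin_num.
  by rewrite fin_numM// fin_num_measure//; exact: measurableC.
by move=> /(congr1 (fun t => t - (h 0%R)%:E * P (~` A))); rewrite !addeK.
Qed.

End symmetric_law.

Lemma indic_pred {T : Type} {R : pzRingType} (p : pred T) (w : T) :
  \1_[set w' | p w'] w = (p w)%:R :> R.
Proof.
rewrite indicE; case: (boolP (p w)) => pw; first by rewrite mem_set.
by rewrite memNset//; exact/negP.
Qed.

(** * Nonnegativity of conditional expectations *)

Section cond_exp_nonnegative.
Context {d} {T : measurableType d} {R : realType} (P : probability T R).
Local Open Scope ereal_scope.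

(** The set [N] where [g] is negative lies in [G], so the integral of |g| over [N] is minus that of
    [f], hence zero; thus [N] is negligible. *)
Lemma cond_exp_version_ge0 (G : set (set T)) (f g : T -> R) :
  G `<=` measurable -> (forall w, 0 <= f w)%R -> cond_exp_version P G f g ->
  {ae P, forall w, (0 <= g w)%R}.
Proof.
move=> GT f0 [mg ig gE]; pose N := [set w | (g w < 0)%R].
have GN : G N.
  rewrite [N](_ : _ = g @^-1` `]-oo, 0%R[%classic); first exact: mg.
  by apply/seteqP; split=> w/=; rewrite in_itv.
have mN := GT _ GN.
have mg' : measurable_fun N (EFin \o g).
  exact/measurable_EFinP/measurable_funTS/(sub_measurable_measurable _ GT).
have : \int[P]_(w in N) `|(g w)%:E| = 0.
  apply/eqP; rewrite eq_le integral_ge0// andbT.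
  rewrite (eq_integral (fun w => - (g w)%:E)); last first.
    by move=> w /[!inE] Nw /=; rewrite ltr0_norm// EFinN.
  rewrite integralN/=; last first.
    apply: integrable_add_def => //.
    exact: (integrableS measurableT mN _ ig).
  by rewrite gE// oppe_le0 integral_ge0// => w _; rewrite lee_fin.
move/(ae_eq_integral_abs P mN mg') => [M [mM M0 NM]].
exists M; split=> // w /= /negP; rewrite -ltNge => gw; apply: NM => /= gw0.
by have [] := gw0 gw; move=> gE0; move: gw; rewrite gE0 ltxx.
Qed.

End cond_exp_nonnegative.

(** * One step of the exponential supermartingale *)

Section supermartingale_step.
Context {d} {T : measurableType d} {R : realType} (P : probability T R).
Local Open Scope ereal_scope.

(** Conditional expectations are handled through integrals over sets of [G]: under a [G]-measurable
    weight, [h (X w)] is exchanged for its symmetrization, and the truncated square [q (X w)] for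
    [c]. *)
Lemma cond_symmetric_exp_le (G : set (set T)) (A : set T) (W X c : T -> R)
    (lam f y : R) :
  sigma_algebra setT G -> G `<=` measurable -> G A ->
  sub_measurable G W -> (forall w, 0 <= W w)%R -> measurable_fun setT X ->
  (forall z : R, (0 <= z)%R -> exists g : T -> R,
     cond_exp_version P G (\1_[set w | X w > z]%R) g /\
     cond_exp_version P G (\1_[set w | X w < - z]%R) g) ->
  cond_exp_version P G (fun w => X w ^+ 2 * \1_[set w' | `|X w'| <= y] w)%R c ->
  (0 <= f)%R -> (lam ^+ 2 / 2 <= f)%R ->
  (forall t : R, `|t| <= y -> coshR (lam * t) <= 1 + f * t ^+ 2)%R ->
  \int[P]_(w in A) (W w * expR (lam * X w -
      f * (c w + X w ^+ 2 * \1_[set w' | `|X w'| > y] w)))%:E <=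
  \int[P]_(w in A) (W w)%:E.
Proof.
move=> sG GT GA mW W0 mX symX cE f0 lamf coshf; have mA := GT _ GA.
have [mc ic intc] := cE.
have mXN : measurable_fun setT (\- X)%R by exact: measurableT_comp.
have mgt : measurable [set t : R | (`|t| > y)%R].
  by apply: measurable_gt_set; exact: normr_measurable.
have mle : measurable [set t : R | (`|t| <= y)%R].
  by apply: measurable_le_set; exact: normr_measurable.
pose q t : R := (t ^+ 2 * \1_[set t : R | `|t| <= y] t)%R.
pose h t : R := expR (lam * t - f * (t ^+ 2 * \1_[set t : R | `|t| > y] t))%R.
have mq : measurable_fun setT q.
  by apply: measurable_funM; [exact: exprn_measurable|exact: measurable_indic].
have mh : measurable_fun setT h.
  apply: measurableT_comp => //; apply: measurable_funB.
    exact: mulrl_measurable.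
  apply: measurable_funM => //.
  by apply: measurable_funM; [exact: exprn_measurable|exact: measurable_indic].
have q0 t : (0 <= q t)%R by rewrite mulr_ge0 ?sqr_ge0.
have h0 t : (0 <= h t)%R by exact: expR_ge0.
(* For [`|t| > y] this is [cosh (lam t) <= exp (lam^2 t^2 / 2) <= exp (f t^2)]. *)
have h_le t : ((h t + h (- t)) / 2 <= 1 + f * q t)%R.
  rewrite /h /q !indic_pred normrN sqrrN mulrN.
  have [ty|ty] := leP `|t|%R y; first by rewrite !mulr0 !subr0 mulr1; exact: coshf.
  rewrite !mulr0 addr0 mulr1 !expRD -mulrDl mulrAC expRN.
  rewrite ler_pdivrMr ?expR_gt0// mul1r (le_trans (coshR_le_expR_sqr _ _))//.
  by rewrite ler_expR exprMn mulrAC ler_wpM2r// sqr_ge0.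
(* The factor exp(-f c) is [G]-measurable and joins the weight. *)
pose V w := (W w * expR (- (f * c w)))%R.
have V0 w : (0 <= V w)%R by rewrite mulr_ge0// expR_ge0.
have mV : sub_measurable G V.
  apply/(sub_measurableP _ sG); apply: measurable_funM.
    exact/(sub_measurableP _ sG).
  apply: measurableT_comp => //; apply: measurableT_comp => //.
  by apply: measurable_funM => //; exact/(sub_measurableP _ sG).
have c0 := cond_exp_version_ge0 P _ _ _ GT (fun w => q0 (X w)) cE.
(* [c] is nonnegative only almost everywhere, while the exchange under a weight asks for it
   everywhere; hence the positive part. *)
pose cp w := Num.max (c w) 0%R.
have mcT : measurable_fun setT c := sub_measurable_measurable _ GT _ mc.
have mVT : measurable_fun setT V := sub_measurable_measurable _ GT _ mV.
have mcp : measurable_fun setT cp by exact: measurable_maxr.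
have cp0 w : (0 <= cp w)%R by rewrite le_max lexx orbT.
have mhX : measurable_fun setT (h \o X) by exact: measurableT_comp.
have mhXN : measurable_fun setT (h \o (\- X)%R) by exact: measurableT_comp.
have mqX : measurable_fun setT (q \o X) by exact: measurableT_comp.
have qcp B : G B -> \int[P]_(w in B) (q (X w))%:E = \int[P]_(w in B) (cp w)%:E.
  move=> GB; rewrite -(intc _ GB); apply: ae_eq_integral; first exact: GT.
  - exact/measurable_EFinP/measurable_funTS.
  - exact/measurable_EFinP/measurable_funTS.
  - by apply: filterS c0 => w cw _ /=; rewrite /cp max_l.
rewrite (eq_integral (fun w => (V w)%:E * (h (X w))%:E)); last first.
  move=> w _; rewrite -EFinM /V -[in RHS]mulrA; congr (_ * _)%:E.
  by rewrite /h -expRD !indic_pred; congr expR; ring.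
pose hs w := ((h (X w) + h (- X w)) / 2)%R.
have hs0 w : (0 <= hs w)%R by rewrite divr_ge0// addr_ge0.
have mhs : measurable_fun setT hs.
  by apply: measurable_funM => //; exact: measurable_funD.
have hsE B : G B -> \int[P]_(w in B) (h (X w))%:E = \int[P]_(w in B) (hs w)%:E.
  move=> GB; have mB := GT _ GB; rewrite /hs.
  under [RHS]eq_integral do rewrite EFinM EFinD.
  have mB1 : measurable_fun B (fun w => (h (X w))%:E).
    exact/measurable_EFinP/measurable_funTS.
  have mB2 : measurable_fun B (fun w => (h (- X w))%:E).
    exact/measurable_EFinP/measurable_funTS.
  rewrite ge0_integralZr//; [|exact: emeasurable_funD|]; last first.
    by move=> w _; rewrite adde_ge0// lee_fin.
  rewrite ge0_integralD//; try by move=> w _; rewrite lee_fin.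
  rewrite -(cond_symmetric_integral P G B X h)//.
  (* The mean of two copies of an extended real is that extended real, infinite values included. *)
  case: (\int[P]_(w in B) (h (X w))%:E) => [r| |].
    by rewrite -EFinD -EFinM; congr EFin; field.
    by rewrite addye// gt0_mulye// lte_fin invr_gt0.
  by rewrite addNye gt0_mulNye// lte_fin invr_gt0.
have mfq : measurable_fun setT (fun w => 1 + f * q (X w))%R.
  by apply: measurable_funD => //; exact: measurable_funM.
have mfcp : measurable_fun setT (fun w => 1 + f * cp w)%R.
  by apply: measurable_funD => //; exact: measurable_funM.
have fq0 w : (0 <= 1 + f * q (X w))%R by rewrite addr_ge0// mulr_ge0.
have fcp0 w : (0 <= 1 + f * cp w)%R by rewrite addr_ge0// mulr_ge0.
have fqE B : G B ->
    \int[P]_(w in B) (1 + f * q (X w))%:E = \int[P]_(w in B) (1 + f * cp w)%:E.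
  move=> GB; have mB := GT _ GB.
  have lin (k : T -> R) : measurable_fun setT k -> (forall w, 0 <= k w)%R ->
      \int[P]_(w in B) (1 + f * k w)%:E = P B + f%:E * \int[P]_(w in B) (k w)%:E.
    move=> mk k0; have mkB : measurable_fun B (fun w => (k w)%:E).
      exact/measurable_EFinP/measurable_funTS.
    under eq_integral do rewrite EFinD EFinM.
    rewrite ge0_integralD//; first last.
    - exact: emeasurable_funM.
    - by move=> w _; rewrite mule_ge0// lee_fin.
    rewrite ge0_integralZl//; first last.
    - by move=> w _; rewrite lee_fin.
    by rewrite integral_cst// mul1e.
  by rewrite lin// lin// qcp.
have mVA (k : T -> R) : measurable_fun setT k ->
    measurable_fun A (fun w => (V w)%:E * (k w)%:E).
  by move=> mk; apply: emeasurable_funM; exact/measurable_EFinP/measurable_funTS.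
rewrite (ge0_eq_integral_weight P G sG GT A (h \o X) hs V GA mhX mhs (fun w => h0 (X w)))//.
apply: (@le_trans _ _ (\int[P]_(w in A) ((V w)%:E * (1 + f * q (X w))%:E))).
  apply: ge0_le_integral => //; [|exact: mVA|exact: mVA|].
  - by move=> w _; rewrite mule_ge0// lee_fin.
  - by move=> w _; rewrite lee_wpmul2l ?lee_fin ?h_le.
rewrite (ge0_eq_integral_weight P G sG GT A
  (fun w => 1 + f * q (X w))%R (fun w => 1 + f * cp w)%R)//.
apply: ae_ge0_le_integral => //; [|exact: mVA| | |].
- by move=> w _; rewrite mule_ge0// lee_fin.
- by move=> w _; rewrite lee_fin.
- exact/measurable_EFinP/measurable_funTS/(sub_measurable_measurable _ GT).
(* Where [c] is nonnegative, [cp] equals [c], and 1 + f c <= exp(f c) absorbs the extra factor of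
   [V]. *)
apply: filterS c0 => w cw _; rewrite -EFinM lee_fin /V -mulrA ler_piMr//.
rewrite expRN mulrC ler_pdivrMr ?expR_gt0// mul1r /cp max_l//.
exact: expR_ge1Dx.
Qed.

End supermartingale_step.

(** * A maximal inequality for nonnegative supermartingales *)

Section maximal_inequality.
Context {d} {T : measurableType d} {R : realType} (mu : {measure set T -> \bar R}).
Local Open Scope ereal_scope.

(* Ville's maximal inequality; the second term on the left makes the induction
   on [n] work. *)
Lemma supermartingale_maximal (F : nat -> set (set T)) (Z : nat -> T -> R) (n : nat) (a : R) :
  (forall i, (i <= n)%N -> sigma_algebra setT (F i)) ->
  (forall i, (i <= n)%N -> F i `<=` measurable) ->
  (forall i, (i < n)%N -> F i `<=` F i.+1) ->
  (forall i, (i <= n)%N -> sub_measurable (F i) (Z i)) ->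
  (forall i w, 0 <= Z i w)%R -> (0 <= a)%R ->
  (forall i A, (i < n)%N -> F i A ->
     \int[mu]_(w in A) (Z i.+1 w)%:E <= \int[mu]_(w in A) (Z i w)%:E) ->
  let hit := [set w | exists2 k, (1 <= k <= n)%N & (a <= Z k w)%R] in
  F n hit /\
  a%:E * mu hit + \int[mu]_(w in ~` hit) (Z n w)%:E <= \int[mu]_w (Z 0%N w)%:E.
Proof.
move=> + + + + Z0 a0; elim: n => [|n IH] sF FT FS ZF ZS hit.
  have -> : hit = set0.
    by rewrite -subset0 => w [k /andP[k1 k0]]; move: (leq_trans k1 k0).
  split; first by have [] := sF 0%N (leqnn _).
  by rewrite measure0 mule0 add0e setC0.
have {IH} := IH (fun i h => sF i (leqW h)) (fun i h => FT i (leqW h))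
  (fun i h => FS i (leqW h)) (fun i h => ZF i (leqW h)) (fun i A h => ZS i A (leqW h)).
set hit' := [set w | _] => -[Fhit' IH].
(* [E] is the event that the level is reached for the first time at [n.+1]. *)
pose E := ~` hit' `&` [set w | (a <= Z n.+1 w)%R].
have hitE : hit = hit' `|` E.
  apply/seteqP; split=> w /=.
  - move=> [k /andP[k1 kn] ak]; have [?|h'] := pselect (hit' w); first by left.
    right; split=> //=; move: kn; rewrite leq_eqVlt => /orP[/eqP <- //|kn].
    by case: h'; exists k => //; rewrite k1.
  - case=> [[k /andP[k1 kn] ak]|[_ /= ak]]; last by exists n.+1; rewrite //=.
    by exists k => //; rewrite k1 (leq_trans kn).
have sFn := sF _ (leqnn n.+1).
have Fn1hit' : F n.+1 hit' by exact: FS.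
have Flevel : F n.+1 [set w | (a <= Z n.+1 w)%R].
  rewrite [X in F _ X](_ : _ = Z n.+1 @^-1` `[a, +oo[%classic); first exact: ZF.
  by apply/seteqP; split=> w/=; rewrite in_itv/= andbT.
have FE : F n.+1 E.
  apply: (g_sigma_algebra_measurable _ sFn); apply: measurableI.
    by apply: measurableC; rewrite (measurable_g_sigma_algebraE _ sFn).
  by rewrite (measurable_g_sigma_algebraE _ sFn).
have Fhit : F n.+1 hit.
  rewrite hitE; apply: (g_sigma_algebra_measurable _ sFn).
  by apply: measurableU; rewrite (measurable_g_sigma_algebraE _ sFn).
split=> //.
have mF A : F n.+1 A -> measurable A by exact: FT.
have mhit' := mF _ Fn1hit'; have mE := mF _ FE; have mhit := mF _ Fhit.
have mZ : measurable_fun setT (EFin \o Z n.+1).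
  apply/measurable_EFinP/(sub_measurable_measurable (F n.+1)); first exact: FT.
  exact: ZF.
have CE : ~` hit' = E `|` ~` hit.
  rewrite hitE setCU; apply/seteqP; split=> w.
    by move=> h'; have [?|?] := pselect (E w); [left|right].
  by case=> [[]|[]].
have muhit : mu hit = mu hit' + mu E.
  rewrite hitE measureU//; apply/seteqP; split=> // w [h' []].
  by move/(_ h').
(* The supermartingale property is used on the complement of [hit'], a set of [F n]. That complement
   then splits into [E], where [Z n.+1] is at least [a], and the complement of [hit]. *)
apply: le_trans IH; apply: (@le_trans _ _
    (a%:E * mu hit' + \int[mu]_(w in ~` hit') (Z n.+1 w)%:E)); last first.
  rewrite leeD2l// ZS//.
  have sn : sigma_algebra setT (F n) by exact: sF.
  apply: (g_sigma_algebra_measurable _ sn); apply: measurableC.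
  by rewrite (measurable_g_sigma_algebraE _ sn).
rewrite CE ge0_integral_setU//; first last.
- by apply/disj_setPLR; rewrite hitE setCK; right.
- by move=> w _; rewrite lee_fin.
- exact: measurable_funTS.
- exact: measurableC.
rewrite [leRHS]addeA leeD2r// muhit muleDr ?ge0_adde_def ?inE//.
apply: leeD => //.
rewrite -integral_cst//; apply: ge0_le_integral => //.
- exact: measurable_funTS.
- by move=> w [_ /= aZ]; rewrite lee_fin.
Qed.

End maximal_inequality.

(** * Choice of the exponents *)

(** Collects what the later steps ask of [lam] and [f], so that [y = 0] and [y > 0] are treated
    alike from there on. *)
Lemma B0_exponential {R : realType} (x y v : R) : 0 < x -> 0 < v -> 0 <= y ->
  exists lam f : R, [/\ 0 <= lam, 0 <= f /\ lam ^+ 2 / 2 <= f,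
    (forall t, `|t| <= y -> coshR (lam * t) <= 1 + f * t ^+ 2) &
    B0 x y v = expR (- (lam * x - f * v ^+ 2))].
Proof.
move=> x0 v0 y0; rewrite /B0; have [->|y_neq0] := eqVneq y 0.
  (* This [lam] minimizes -lam x + lam^2 v^2 / 2, with minimum -x^2 / (2 v^2). *)
  exists (x / v ^+ 2), ((x / v ^+ 2) ^+ 2 / 2); split.
  - by rewrite divr_ge0// ?ltW// exprn_gt0.
  - by rewrite divr_ge0// sqr_ge0.
  - move=> t; rewrite normr_le0 => /eqP ->; rewrite mulr0 expr0n/= mulr0 addr0.
    by rewrite /coshR oppr0 expR0; lra.
  - by congr expR; field; rewrite gt_eqF.
set lam := _ / y.
have y_gt0 : 0 < y by rewrite lt_neqAle eq_sym y_neq0.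
have lam0 : 0 <= lam.
  rewrite divr_ge0// ln_ge0// ler_wpDr//.
    by rewrite divr_ge0 ?sqr_ge0// mulr_ge0// ltW.
  have q0 : 0 <= x ^+ 2 * y ^+ 2 / v ^+ 4.
    by apply: divr_ge0; [rewrite mulr_ge0 ?sqr_ge0|exact/exprn_ge0/ltW].
  by rewrite -[leLHS]sqrtr1 ler_sqrt ?lerDl// addr_ge0.
clearbody lam; exists lam, ((coshR (lam * y) - 1) / y ^+ 2); split=> //.
- have lamf : lam ^+ 2 / 2 <= (coshR (lam * y) - 1) / y ^+ 2.
    rewrite ler_pdivlMr ?exprn_gt0// lerBrDl (le_trans _ (coshR_ge1D _ _))//.
    by rewrite exprMn mulrAC.
  by split=> //; apply: le_trans lamf; rewrite divr_ge0// sqr_ge0.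
- move=> t ty; rewrite -lerBlDl.
  (* The monotonicity of (cosh s - 1) / s^2 is applied at [lam * t] and [lam * y], and a factor
     lam^2 is cancelled; for [lam = 0] both sides vanish. *)
  have [->|lam_neq0] := eqVneq lam 0.
    by rewrite !mul0r /coshR oppr0 expR0; lra.
  have : `|lam * t| <= lam * y by rewrite normrM ger0_norm// ler_wpM2l.
  move=> /coshR_quadratic_le key.
  have lam2 : 0 < lam ^+ 2 by rewrite exprn_gt0// lt_neqAle eq_sym lam_neq0.
  rewrite mulrAC ler_pdivlMr ?exprn_gt0// -(ler_pM2r lam2); lra.
- by congr expR; rewrite mulNr; ring.
Qed.

(** * The exponential supermartingale of [xi] and the tail bound *)

Theorem theorem2p3 (d : measure_display) (T : measurableType d) (R : realType)
  (P : probability T R) (n : nat) (F : nat -> set (set T))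
  (xi : nat -> T -> R) (c : nat -> T -> R) (x y v : R) :
  (* filtration F_0 = {emptyset, Omega} ⊆ F_1 ⊆ ... ⊆ F_n ⊆ measurable *)
  (forall i, (i <= n)%N -> sigma_algebra setT (F i)) ->
  (forall i, (i <= n)%N -> F i `<=` measurable) ->
  (forall i, (i < n)%N -> F i `<=` F i.+1) ->
  F 0%N = [set set0; setT] ->
  (* conditionally symmetric martingale differences *)
  (forall i, (1 <= i <= n)%N -> sub_measurable (F i) (xi i)) ->
  (forall i, (1 <= i <= n)%N -> P.-integrable setT (fun w => (xi i w)%:E)) ->
  (forall i, (1 <= i <= n)%N -> cond_exp_version P (F i.-1) (xi i) (cst 0)) ->
  (forall i, (1 <= i <= n)%N -> forall z : R, 0 <= z ->
     exists g : T -> R,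
       cond_exp_version P (F i.-1) (\1_[set w | xi i w > z]) g /\
       cond_exp_version P (F i.-1) (\1_[set w | xi i w < - z]) g) ->
  (* c i is a version of E(xi_i^2 1_{|xi_i| <= y} | F_{i-1}) *)
  (forall i, (1 <= i <= n)%N ->
     cond_exp_version P (F i.-1)
       (fun w => xi i w ^+ 2 * \1_[set w' | `|xi i w'| <= y] w) (c i)) ->
  0 < x -> 0 < v -> 0 <= y ->
  (P [set w | exists k : nat, [/\ (1 <= k <= n)%N,
        (\sum_(1 <= i < k.+1) xi i w >= x)%R &
        (\sum_(1 <= i < k.+1)
           (c i w + xi i w ^+ 2 * \1_[set w' | `|xi i w'| > y] w) <= v ^+ 2)%R]]
   <= (B0 x y v)%:E)%E.
Proof.
move=> sF FT FS F0 mxi _ _ symxi cE x0 v0 y0; set event := [set w | _].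
have [lam [f [lam0 [f0 lamf] coshf ->]]] := B0_exponential _ _ _ x0 v0 y0.
pose step i w := expR (lam * xi i w -
  f * (c i w + xi i w ^+ 2 * \1_[set w' | `|xi i w'| > y] w)).
(* The product form gives the one-step recursion; the closed form [ZE] serves to compare with the
   level [a]. *)
pose Z k w := \prod_(1 <= i < k.+1) step i w.
have Z0 k w : 0 <= Z k w by apply: prodr_ge0 => i _; exact: expR_ge0.
have ZS k w : Z k.+1 w = Z k w * step k.+1 w by rewrite /Z big_nat_recr.
have ZE k w : Z k w = expR (lam * (\sum_(1 <= i < k.+1) xi i w) -
    f * (\sum_(1 <= i < k.+1)
      (c i w + xi i w ^+ 2 * \1_[set w' | `|xi i w'| > y] w))).
  rewrite /Z; elim: k => [|k IH]; first by rewrite !big_geq// !mulr0 subr0 expR0.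
  by rewrite !(big_nat_recr k.+1)//= IH -expRD; congr expR; ring.
have mZ k : (k <= n)%N -> sub_measurable (F k) (Z k).
  elim: k => [|k IH] kn.
    apply/(sub_measurableP _ (sF _ kn)).
    rewrite (_ : Z 0%N = cst 1)//; apply/funext => w.
    by rewrite /Z big_geq.
  have FkS := FS k kn; have sS := sF _ kn.
  have mX : measurable_fun setT (xi k.+1 : g_sigma_algebraType (F k.+1) -> R).
    exact/(sub_measurableP _ sS)/mxi.
  (* [c k.+1] is already [F k]-measurable, being a conditional expectation given the past. *)
  have mc : measurable_fun setT (c k.+1 : g_sigma_algebraType (F k.+1) -> R).
    apply/(sub_measurableP _ sS) => B mB; apply: FkS.
    by have [mc _ _] := cE k.+1 kn; exact: mc.
  have mZk : measurable_fun setT (Z k : g_sigma_algebraType (F k.+1) -> R).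
    by apply/(sub_measurableP _ sS) => B mB; apply: FkS; exact: (IH (ltnW kn)).
  apply/(sub_measurableP _ sS); rewrite (_ : Z k.+1 = fun w => Z k w * step k.+1 w).
    apply: measurable_funM => //; apply: measurableT_comp => //.
    apply: measurable_funB; first exact: measurable_funM.
    apply: measurable_funM => //; apply: measurable_funD => //.
    apply: measurable_funM; first exact: measurable_funX.
    by apply/measurable_indic/measurable_gt_set; exact: measurableT_comp.
  by apply/funext => w; exact: ZS.
have superZ k A : (k < n)%N -> F k A ->
    (\int[P]_(w in A) (Z k.+1 w)%:E <= \int[P]_(w in A) (Z k w)%:E)%E.
  move=> kn FA; under eq_integral do rewrite ZS.
  apply: (cond_symmetric_exp_le P (F k) A (Z k) (xi k.+1) (c k.+1) lam f y) => //.
  - exact/sF/ltnW.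
  - exact/FT/ltnW.
  - exact/mZ/ltnW.
  - by apply: (sub_measurable_measurable (F k.+1)); [exact: FT|exact: mxi].
  - exact: (symxi k.+1 kn).
  - exact: (cE k.+1 kn).
pose a := expR (lam * x - f * v ^+ 2).
have [Fhit ville] := supermartingale_maximal P F Z n a sF FT FS mZ Z0 (expR_ge0 _) superZ.
set hit := [set w | _] in Fhit ville.
have mhit : measurable hit by exact: FT Fhit.
(* [Z 0] is the empty product 1, of integral 1, and the nonnegative second term of the maximal
   inequality is dropped. *)
have Phit : (a%:E * P hit <= 1)%E.
  have : (\int[P]_w (Z 0%N w)%:E = 1)%E.
    rewrite (eq_integral (cst 1%E)); last by move=> w _; rewrite /Z big_geq.
    by rewrite integral_cst// mul1e; exact: probability_setT.
  move=> <-; apply: le_trans ville; rewrite leeDl//.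
  by apply: integral_ge0 => w _; rewrite lee_fin.
have mxiT i : (1 <= i <= n)%N -> measurable_fun setT (xi i).
  move=> /[dup] i1n /andP[_ /FT FiT].
  by apply: (sub_measurable_measurable (F i)) => //; exact: mxi.
have mcT i : (1 <= i <= n)%N -> measurable_fun setT (c i).
  by move=> /cE[_ /measurable_int/measurable_EFinP].
have msum (u : nat -> T -> R) k : (k <= n)%N ->
    (forall i, (1 <= i <= n)%N -> measurable_fun setT (u i)) ->
    measurable_fun setT (fun w => \sum_(1 <= i < k.+1) u i w).
  move=> + mu; elim: k => [|k IH] kn.
    by rewrite (_ : (fun w => _) = cst 0)//; apply/funext => w; rewrite big_geq.
  under eq_fun do rewrite big_nat_recr//=.
  by apply: measurable_funD; [exact/IH/ltnW|exact: mu].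
(* Monotonicity of [P] is applied to [event] and [hit], so both have to be measurable. *)
have mevent : measurable event.
  rewrite (_ : event = \bigcup_(k in [set k | (1 <= k <= n)%N])
      ([set w | x <= \sum_(1 <= i < k.+1) xi i w] `&`
       [set w | \sum_(1 <= i < k.+1)
         (c i w + xi i w ^+ 2 * \1_[set w' | `|xi i w'| > y] w) <= v ^+ 2])).
    apply: bigcup_measurable => k /andP[_ kn]; apply: measurableI.
      by apply: measurable_ge_set; exact: msum.
    apply: measurable_le_set; apply: msum => // i i1n.
    apply: measurable_funD; first exact: mcT.
    apply: measurable_funM; first exact/measurable_funX/mxiT.
    by apply/measurable_indic/measurable_gt_set; apply: measurableT_comp => //; exact: mxiT.
  by apply/seteqP; split=> w; [case=> k [k1n Sx Mv]; exists k|case=> k k1n [Sx Mv]; exists k].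
apply: (@le_trans _ _ (P hit)).
  apply: le_measure; rewrite ?inE//.
  move=> w [k [k1n Sx Mv]]; exists k => //.
  rewrite ZE /a ler_expR; apply: lerB; first exact: ler_wpM2l.
  exact: ler_wpM2l.
(* The bound is the inverse of the level [a]. *)
by rewrite expRN -/a -[leRHS]mule1 lee_pdivlMl// expR_gt0.
Qed.
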